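(* Let $V$ be a complex inner product space of finite dimension $\dim V\geq 2$. Let $G=\langle\sigma_1\sigma_2\cdots\sigma_p\rangle$ be the cyclic group generated by the product $\sigma_1\sigma_2\cdots\sigma_p$, where $\sigma_i$ ($1\le i\le p$) are disjoint cycles in $S_m$ of orders $m_1,\ldots,m_p$, respectively. Assume $m=\sum_{i=1}^p m_i$, let $M$ be the least common multiple of $m_1,\ldots,m_p$, and let $\lambda_q$, $0\le q\le M-1$, be the irreducible complex character of $G$ given by $\lambda_q\big((\sigma_1\cdots\sigma_p)^s\big)=\exp\left(\frac{2\pi\sqrt{-1}\,qs}{M}\right)$, $s=0,\ldots,M-1$. Then $$\dim V^{\lambda_q}(G)=(\dim V)\sum_{i=1}^{p}\frac{1}{m_i'}\sum_{d\mid m_i'}c_{m_i'/d}(q),$$ where $m_i'=M/m_i$. In particular, if $G$ is generated by an $m$-cycle in $S_m$, then $\dim V^{\lambda_q}(G)=\dim V$.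
   Context: $\times^m V$ is the Cartesian product of $m$ copies of $V$. For $\tau\in G\le S_m$, $Q(\tau):\times^m V\to\times^m V$ is the linear operator $Q(\tau)(u_1,\ldots,u_m)=(u_{\tau^{-1}(1)},\ldots,u_{\tau^{-1}(m)})$. For a complex irreducible character $\lambda$ of $G$, the Cartesian symmetrizer is $C_\lambda=\frac{\lambda(1)}{|G|}\sum_{\tau\in G}\lambda(\tau)Q(\tau)$, and the Cartesian symmetry class associated with $G$ and $\lambda$ is the range $V^\lambda(G)=C_\lambda(\times^m V)$. For a positive integer $k$ and a non-negative integer $q$, the Ramanujan sum is $c_k(q)=\sum_{0\le s\le k-1,\ \gcd(s,k)=1}\exp\left(\frac{2\pi\sqrt{-1}\,qs}{k}\right)$ (so $c_1(q)=1$, since $\gcd(0,1)=1$). *)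

(* Defs.v *)
From HB Require Import structures.
From mathcomp Require Export all_boot all_order all_algebra all_fingroup.
From mathcomp Require Export sesquilinear mxrepresentation complex.
From mathcomp Require Export reals trigo.

Set Implicit Arguments.
Unset Strict Implicit.
Unset Printing Implicit Defensive.

Import Order.TTheory GRing.Theory Num.Theory.

Local Open Scope ring_scope.
Local Open Scope complex_scope.

(* The complex number exp (sqrt (-1) * t). *)
Definition expi (R : realType) (t : R) : R[i] := cos t +i* sin t.

Definition ramanujan (R : realType) (k q : nat) : R[i] :=
  \sum_(s < k | coprime s k) expi (2 * pi * q%:R * s%:R / k%:R).

(* The elements moved by s, if any, form a single orbit. The identity of a
   nonempty set is thus a cycle, of length and order 1. *)
Definition is_cycle (T : finType) (s : {perm T}) : Prop :=
  exists x : T, forall y : T, s y != y -> y \in porbit s x.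

Definition perm_disjoint (T : finType) (s t : {perm T}) : Prop :=
  forall x : T, s x = x \/ t x = x.

(* MathComp's 'CF(G) and irr G take values in the algebraic numbers algC; this
   is the notion over an arbitrary field F. Values outside G are irrelevant. *)
Definition irreducible_character (F : fieldType) (gT : finGroupType)
    (G : {group gT}) (lambda : gT -> F) : Prop :=
  exists (n : nat) (rG : mx_representation F G n),
    mx_irreducible rG /\ forall x : gT, x \in G -> lambda x = \tr (rG x).

Section CartesianSymmetryClass.

Variables (F : fieldType) (V : vectType F) (m : nat).

Definition Q_fun (tau : 'S_m) (u : {ffun 'I_m -> V}) : {ffun 'I_m -> V} :=
  [ffun i => u ((tau^-1)%g i)].

Lemma Q_fun_is_linear (tau : 'S_m) : linear (Q_fun tau).
Proof. by move=> a u v; apply/ffunP=> i; rewrite !ffunE. Qed.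

HB.instance Definition _ (tau : 'S_m) :=
  GRing.isLinear.Build F {ffun 'I_m -> V} {ffun 'I_m -> V} _ (Q_fun tau)
    (Q_fun_is_linear tau).

Definition Q (tau : 'S_m) : 'End({ffun 'I_m -> V}) := linfun (Q_fun tau).

Definition cartesian_symmetrizer (G : {group 'S_m}) (lambda : 'S_m -> F) :
    'End({ffun 'I_m -> V}) :=
  (lambda 1%g / #|G|%:R) *: \sum_(tau in G) lambda tau *: Q tau.

Definition symmetry_class (G : {group 'S_m}) (lambda : 'S_m -> F) :
    {vspace {ffun 'I_m -> V}} :=
  limg (cartesian_symmetrizer G lambda).

End CartesianSymmetryClass.

Arguments symmetry_class {F} V {m} G lambda.

(* Main.v *)
(* The symmetrizer acts on (u_1, ..., u_m) through an m x m matrix of scalars, so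
   the dimension of its range is dim V times the rank of that matrix. For a
   linear character the matrix is idempotent, hence its rank is its trace
   1/|G| * sum_s lambda(g^s) #Fix(g^s). A power g^s fixes the points of the i-th
   cycle iff m_i | s, so the i-th cycle contributes 1/m'_i times
   sum_(j < m'_i) exp(2 pi i q j / m'_i), which splits into Ramanujan sums
   according to the value of gcd(j, m'_i). *)

From HB Require Import structures.
Require Import Defs.
From mathcomp Require Import cyclic.

Set Implicit Arguments.
Unset Strict Implicit.
Unset Printing Implicit Defensive.

Import GRing.Theory Num.Theory.
Local Open Scope ring_scope.
Local Open Scope complex_scope.

(** * Scalar matrices acting on tuples of vectors *)

Section MatrixAction.

Variables (F : fieldType) (V : vectType F).

Definition mxact m n (A : 'M[F]_(m, n)) (u : {ffun 'I_n -> V}) :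
    {ffun 'I_m -> V} :=
  [ffun i => \sum_k A i k *: u k].

Lemma mxact_is_linear m n (A : 'M[F]_(m, n)) : linear (@mxact m n A).
Proof.
move=> a u v; apply/ffunP=> i; rewrite !ffunE scaler_sumr -big_split /=.
by apply: eq_bigr => k _; rewrite !ffunE scalerDr !scalerA mulrC.
Qed.

HB.instance Definition _ m n (A : 'M[F]_(m, n)) :=
  GRing.isLinear.Build F {ffun 'I_n -> V} {ffun 'I_m -> V} _ (@mxact m n A)
    (@mxact_is_linear m n A).

Lemma mxactM m n p (A : 'M[F]_(m, n)) (B : 'M[F]_(n, p)) u :
  mxact (A *m B) u = mxact A (mxact B u).
Proof.
apply/ffunP=> i; rewrite !ffunE.
under eq_bigr do rewrite mxE scaler_suml.
rewrite exchange_big /=; apply: eq_bigr => k _.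
by rewrite ffunE scaler_sumr; apply: eq_bigr => l _; rewrite scalerA.
Qed.

Lemma mxact1 n (u : {ffun 'I_n -> V}) : mxact 1%:M u = u.
Proof.
apply/ffunP=> i; rewrite ffunE (bigD1 i) //= mxE eqxx scale1r big1 ?addr0 //.
by move=> k; rewrite mxE eq_sym => /negbTE ->; rewrite scale0r.
Qed.

(** Rank factorization: [row_base A] has a right inverse, so it acts surjectively onto the tuples of
    length [\rank A], and [col_base A] has a left inverse, so it acts injectively on them. *)
Lemma dim_limg_mxact m n (A : 'M[F]_(m, n)) :
  \dim (limg (linfun (@mxact m n A))) = (\rank A * \dim {:V})%N.
Proof.
have -> : linfun (@mxact m n A) =
    (linfun (mxact (col_base A)) \o linfun (mxact (row_base A)))%VF.
  apply/lfunP=> u; rewrite comp_lfunE !lfunE /=.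
  by rewrite -mxactM mulmx_base.
rewrite limg_comp.
have -> : limg (linfun (mxact (row_base A))) = fullv.
  apply/eqP; rewrite eqEsubv subvf; apply/subvP=> u _; apply/memv_imgP.
  exists (mxact (pinvmx (row_base A)) u); first exact: memvf.
  by rewrite lfunE /= -mxactM mulmxVp ?row_base_free // mxact1.
rewrite limg_dim_eq; first by rewrite !dimvf /dim /= card_ord.
have ker0: lker (linfun (mxact (col_base A))) == 0%VS.
  apply/lker0P => u v; rewrite !lfunE /= => /(congr1 (mxact (pinvmx (col_base A)))).
  by rewrite -!mxactM mulVpmx ?col_base_full // !mxact1.
by rewrite (eqP ker0) capv0.
Qed.

End MatrixAction.

(** Write [A = C *m R] with [C] of full column rank and [R] of full row rank. Cancelling [C] and [R]
    in [C R C R = C R] leaves [R C = 1], and [C R] and [R C] have the same trace. *)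
Lemma mxtrace_idempotent (F : fieldType) n (A : 'M[F]_n) :
  A *m A = A -> \tr A = (\rank A)%:R.
Proof.
move=> idA; rewrite -{1}(mulmx_base A) mxtrace_mulC.
suff -> : row_base A *m col_base A = 1%:M by rewrite mxtrace1.
apply: (row_full_inj (col_base_full A)); apply: (row_free_inj (row_base_free A)).
by rewrite mulmx1 mulmxA -mulmxA !mulmx_base.
Qed.

Lemma mxtrace_perm_mx (R : nzRingType) n (s : 'S_n) :
  \tr (perm_mx s : 'M[R]_n) = #|[pred i | s i == i]|%:R.
Proof.
rewrite -sumr_const /mxtrace [RHS]big_mkcond /=; apply: eq_bigr => i _.
by rewrite !mxE inE; case: eqP.
Qed.

(** * The symmetrizer of a linear character as an idempotent matrix *)

Section Symmetrizer.

Variables (F : fieldType) (m : nat) (G : {group 'S_m}) (lambda : 'S_m -> F).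

(** Row [i] of [perm_mx s] has its 1 in column [s i], so the inverse here selects the entry of index
    [tau^-1 i], as [Q tau] does. *)
Definition symmetrizer_mx : 'M[F]_m :=
  (lambda 1%g / #|G|%:R) *: \sum_(tau in G) lambda tau *: perm_mx (tau^-1)%g.

Lemma cartesian_symmetrizerE (V : vectType F) :
  cartesian_symmetrizer V G lambda = linfun (mxact (V := V) symmetrizer_mx).
Proof.
apply/lfunP=> u; rewrite /cartesian_symmetrizer [RHS]lfunE /=.
rewrite scale_lfunE sum_lfunE; apply/ffunP=> i.
rewrite !ffunE sum_ffunE.
under [RHS]eq_bigr => k _.
  rewrite mxE summxE -scalerA scaler_suml.
  over.
rewrite -scaler_sumr exchange_big /=; congr (_ *: _); apply: eq_bigr => t _.
rewrite scale_lfunE lfunE /= !ffunE (bigD1 ((t^-1)%g i)) //= !mxE eqxx mulr1.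
rewrite big1 ?addr0 // => k; rewrite !mxE eq_sym => /negbTE ->.
by rewrite mulr0 scale0r.
Qed.

Hypothesis lambda1 : lambda 1%g = 1.
Hypothesis lambdaM : {in G &, {morph lambda : x y / (x * y)%g >-> x * y}}.
Hypothesis charFG : #|G|%:R != 0 :> F.

Lemma symmetrizer_mx_idempotent :
  symmetrizer_mx *m symmetrizer_mx = symmetrizer_mx.
Proof.
rewrite /symmetrizer_mx lambda1 mul1r -scalemxAl -scalemxAr scalerA -scalerA.
congr (_ *: _); rewrite mulmx_suml.
(* Each term of the left factor is absorbed by the sum: [t^-1 * s^-1] is the inverse of [s * t], and
   [lambda] is multiplicative, so translating by [t] permutes the terms. The [#|G|] equal sums then
   cancel one factor [#|G|^-1]. *)
have E t : t \in G ->
    lambda t *: perm_mx (t^-1)%g *m (\sum_(s in G) lambda s *: perm_mx (s^-1)%g)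
    = \sum_(s in G) lambda s *: perm_mx (s^-1)%g :> 'M[F]_m.
  move=> Gt; rewrite mulmx_sumr [RHS](reindex_inj (mulIg t)) /=.
  apply: eq_big => [s|s Gs]; first by rewrite groupMr.
  rewrite -scalemxAl -scalemxAr scalerA invMg perm_mxM lambdaM //.
  by rewrite mulrC.
by rewrite (eq_bigr _ E) sumr_const -scaler_nat scalerA mulVf ?scale1r.
Qed.

Lemma dim_symmetry_class (V : vectType F) :
  (\dim (symmetry_class V G lambda))%:R =
  (\dim {:V})%:R *
    (#|G|%:R^-1 * \sum_(t in G) lambda t * #|[pred i | t i == i]|%:R).
Proof.
rewrite /symmetry_class cartesian_symmetrizerE dim_limg_mxact mulnC natrM.
congr (_ * _); rewrite -(mxtrace_idempotent symmetrizer_mx_idempotent).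
rewrite mxtraceZ lambda1 mul1r raddf_sum; congr (_ * _); apply: eq_bigr => t _.
rewrite /= mxtraceZ mxtrace_perm_mx; congr (_ * _%:R); apply: eq_card => i.
(* A permutation and its inverse fix the same points. *)
by rewrite !inE (can2_eq (permKV t) (permK t)) eq_sym.
Qed.

End Symmetrizer.

Lemma big_cycle (R : Type) (idx : R) (op : Monoid.com_law idx)
    (gT : finGroupType) (g : gT) (f : gT -> R) :
  \big[op/idx]_(x in <[g]>%g) f x = \big[op/idx]_(s < #[g]%g) f (g ^+ s)%g.
Proof.
have -> : <[g]>%g = [set (g ^+ (s : 'I_#[g]%g))%g | s in setT].
  apply/setP=> x; apply/idP/imsetP => [|[s _ ->]]; last exact: mem_cycle.
  by case/cyclePmin=> s lts ->; exists (Ordinal lts).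
rewrite big_imset /=; first by apply: eq_bigl => s; rewrite inE.
move=> s t _ _ /eqP; rewrite eq_expg_mod_order !modn_small //.
by move/eqP/val_inj.
Qed.

(** * Fixed points of powers of a single cycle *)

Section Cycle.

Variables (T : finType) (s : {perm T}).

(** Powers of [s] commute, so [s ^+ n] treats all points of an orbit alike. *)
Lemma porbit_expg_fix x y n :
  y \in porbit s x -> ((s ^+ n)%g y == y) = ((s ^+ n)%g x == x).
Proof.
case/porbitP=> k ->; rewrite -permM -expgD addnC expgD permM.
by rewrite (inj_eq perm_inj).
Qed.

Lemma expg_fix n x : s x = x -> (s ^+ n)%g x = x.
Proof. by move=> sx; rewrite permX; elim: n => //= n ->. Qed.

Hypothesis cycle_s : is_cycle s.

(** All moved points share the orbit of [x], so a power fixing [x] fixes them all, hence is the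
    identity. *)
Lemma is_cycle_expg_fix x n : s x != x -> ((s ^+ n)%g x == x) = (#[s]%g %| n)%N.
Proof.
move=> sx; rewrite order_dvdn; apply/idP/idP => [snx|/eqP->]; last by rewrite perm1.
have [x0 cyc] := cycle_s; have xx0 := cyc x sx.
apply/eqP/permP => y; rewrite perm1; have [/expg_fix-> //|/cyc yx0] := eqVneq (s y) y.
by apply/eqP; rewrite (porbit_expg_fix _ yx0) -(porbit_expg_fix _ xx0).
Qed.

(** The support is the orbit of any moved point [x]. The powers of [s] reach at most [#[s]] points;
    conversely, iterating [s] as often as the orbit has points returns to [x], so [#[s]] divides
    that number. The identity is excluded: its order is 1 but its support is empty. *)
Lemma card_support_cycle : #[s]%g != 1%N -> #|[pred x | s x != x]| = #[s]%g.
Proof.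
move=> ns1; have [x sx] : exists x, s x != x.
  apply/existsP; apply: contraR ns1 => /existsPn s1.
  by rewrite order_eq1; apply/eqP/permP=> x; rewrite perm1; apply/eqP/negPn/s1.
have [x0 cyc] := cycle_s.
have -> : #|[pred x | s x != x]| = #|porbit s x|.
  apply: eq_card => y; rewrite inE; apply/idP/idP => [sy|].
    by move: (cyc y sy) (cyc x sx); rewrite -!eq_porbit_mem => /eqP-> /eqP->.
  by move/(@porbit_expg_fix _ _ 1); rewrite expg1 => ->.
apply/eqP; rewrite eqn_leq; apply/andP; split.
  rewrite -[X in (_ <= X)%N]card_ord.
  apply: leq_trans (leq_image_card (fun i : 'I_#[s]%g => (s ^+ i)%g x) predT).
  apply/subset_leq_card/subsetP=> y /porbitPmin[i lti ->].
  by apply/imageP; exists (Ordinal lti).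
apply: dvdn_leq; first by rewrite lt0n card_porbit_neq0.
by rewrite -(is_cycle_expg_fix _ sx) permX iter_porbit.
Qed.

End Cycle.

(** * Products of disjoint cycles: order and fixed points of powers *)

Section DisjointCycles.

Variables (T : finType) (p : nat) (sigma : 'I_p -> {perm T}).
Hypothesis cycle_sigma : forall i, is_cycle (sigma i).
Hypothesis disj_sigma : forall i j, i != j -> perm_disjoint (sigma i) (sigma j).

Let g : {perm T} := (\prod_(i < p) sigma i)%g.

Lemma prod_perm_id (r : seq 'I_p) x :
  (forall i, i \in r -> sigma i x = x) -> (\prod_(i <- r) sigma i)%g x = x.
Proof.
elim: r => [|i r IHr] fix_x; first by rewrite big_nil perm1.
rewrite big_cons permM fix_x ?mem_head // IHr // => j rj.
by rewrite fix_x // inE rj orbT.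
Qed.

Lemma disjoint_perm_fix i j x : sigma i x != x -> j != i -> sigma j x = x.
Proof.
move=> six ji; have [-> //|sx] := disj_sigma ji x; by rewrite sx eqxx in six.
Qed.

(** Factors act from left to right: those before [sigma i] fix [x], and those after it fix
    [sigma i x], which [sigma i] also moves by injectivity. *)
Lemma prod_disjoint_perm i x : sigma i x != x -> g x = sigma i x.
Proof.
move=> six; rewrite /g /index_enum -enumT /=.
have [r1 [r2 [er i1 i2]]] : exists r1 r2,
    [/\ enum 'I_p = r1 ++ i :: r2, i \notin r1 & i \notin r2].
  have := enum_uniq 'I_p; have /splitPr[r1 r2] := mem_enum 'I_p i.
  rewrite uniq_catC /= mem_cat negb_or => /andP[/andP[? ?] _].
  by exists r1, r2.
rewrite er big_cat big_cons !permM /=.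
rewrite (@prod_perm_id r1); last first.
  move=> j jr1; apply: disjoint_perm_fix six _.
  by apply: contraNneq i1 => <-.
rewrite prod_perm_id // => j jr2; apply: (@disjoint_perm_fix i).
  by rewrite (inj_eq perm_inj).
by apply: contraNneq i2 => <-.
Qed.

Lemma expg_prod_disjoint_perm i x n :
  sigma i x != x -> (g ^+ n)%g x = (sigma i ^+ n)%g x.
Proof.
move=> six; elim: n => [|n IHn]; first by rewrite !expg0.
rewrite !expgSr !permM IHn (@prod_disjoint_perm i) //.
by rewrite -permM -expgSr expgS permM (inj_eq perm_inj).
Qed.

Lemma expg_prod_id x n : (forall i, sigma i x = x) -> (g ^+ n)%g x = x.
Proof. by move=> fix_x; apply: expg_fix; apply: prod_perm_id. Qed.

(** On the support of [sigma i], powers of [g] agree with powers of [sigma i]. One moved point per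
    nontrivial cycle gives divisibility by the lcm; checking every point gives the converse. *)
Lemma order_prod_disjoint_cycles :
  #[g]%g = (\big[lcmn/1]_(i < p) #[sigma i]%g)%N.
Proof.
apply/eqP; rewrite eqn_dvd; apply/andP; split; last first.
  apply/dvdn_biglcmP=> i _; have [->|] := eqVneq #[sigma i]%g 1%N; first exact: dvd1n.
  move/(card_support_cycle (cycle_sigma i)) => card_i.
  have /card_gt0P[x] : (0 < #|[pred x | sigma i x != x]|)%N by rewrite card_i order_gt0.
  rewrite inE => six; rewrite -(is_cycle_expg_fix (cycle_sigma i) _ six).
  by rewrite -(expg_prod_disjoint_perm _ six) expg_order perm1.
rewrite order_dvdn; apply/eqP/permP=> x; rewrite perm1.
have [/existsP[i six]|/existsPn fix_x] := boolP [exists i, sigma i x != x].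
  rewrite (expg_prod_disjoint_perm _ six); apply/eqP.
  by rewrite is_cycle_expg_fix // (biglcmn_sup i).
by apply: expg_prod_id => i; apply/eqP/negPn/fix_x.
Qed.

(** The supports are pairwise disjoint and, with the common fixed points, cover [T]; [P] is constant
    on each support. *)
Lemma card_split_supports (P : pred T) (a : pred 'I_p) :
    (forall i x, sigma i x != x -> P x = a i) ->
    (forall x, (forall i, sigma i x = x) -> P x) ->
  #|P| = (\sum_(i < p | a i) #|[pred x | sigma i x != x]| +
          #|[pred x | [forall i, sigma i x == x]]|)%N.
Proof.
move=> Pa Pfix; rewrite -!sum1_card.
under [X in (X + _)%N]eq_bigr => i _.
  rewrite -sum1_card big_mkcond /=.
  over.
rewrite exchange_big /= big_mkcond [X in (_ + X)%N]big_mkcond -big_split /=.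
apply: eq_bigr => x _; rewrite -[x \in P]/(P x) inE.
have [/existsP[i six]|/existsPn fix_x] := boolP [exists i, sigma i x != x].
  have -> : [forall i, sigma i x == x] = false.
    by apply/negbTE; rewrite negb_forall; apply/existsP; exists i.
  rewrite addn0 (Pa i) // big_mkcond (bigD1 i) //= inE six big1 ?addn0 //.
  move=> j ji; rewrite inE (disjoint_perm_fix six ji) eqxx /=.
  by case: ifP.
have fixx i : sigma i x = x by apply/eqP/negPn/fix_x.
rewrite Pfix // big1 => [|i _]; last by rewrite inE fixx eqxx.
by rewrite add0n; have -> : [forall i, sigma i x == x] by apply/forallP=> i; apply/eqP.
Qed.

(* A trivial cycle has order 1 but empty support, so trivial cycles are not
   attached to particular points; that there are as many of them as points
   fixed by every cycle follows from [#|T|] being the sum of the orders. *)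
Lemma card_fix_expg_prod n : #|T| = (\sum_(i < p) #[sigma i]%g)%N ->
  #|[pred x | (g ^+ n)%g x == x]| =
  (\sum_(i < p | #[sigma i]%g %| n) #[sigma i]%g)%N.
Proof.
move=> sum_order; set U := #|[pred x | [forall i, sigma i x == x]]|.
have order_supp i :
    #[sigma i]%g = (#|[pred x | sigma i x != x]| + (#[sigma i]%g == 1%N))%N.
  have [o1|/(card_support_cycle (cycle_sigma i))->] := eqVneq #[sigma i]%g 1%N.
    rewrite o1 eq_card0 // => x; rewrite inE.
    by move/eqP: o1; rewrite order_eq1 => /eqP->; rewrite perm1 eqxx.
  by rewrite addn0.
(* Splitting all of [T] by supports and comparing with the sum of the orders isolates [U]. *)
have U_triv : U = (\sum_(i < p) (#[sigma i]%g == 1%N))%N.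
  move: sum_order; rewrite (card_split_supports (a := predT)) //.
  under [RHS]eq_bigr do rewrite order_supp.
  by rewrite big_split /= => /addnI.
rewrite (card_split_supports (a := fun i => #[sigma i]%g %| n)%N) -/U; first last.
- by move=> x fix_x; rewrite inE expg_prod_id.
- move=> i x six; rewrite inE (expg_prod_disjoint_perm _ six).
  exact: is_cycle_expg_fix.
under [RHS]eq_bigr do rewrite order_supp.
rewrite big_split /=; congr (_ + _)%N; rewrite U_triv [RHS]big_mkcond /=.
(* Order 1 divides every [n], so a trivial cycle is always counted. *)
by apply: eq_bigr => i _; case: eqP => [->|]; rewrite ?dvd1n //; case: ifP.
Qed.

End DisjointCycles.

Lemma sum_dvdn (R : nmodType) (a b : nat) (P : pred nat) (f : nat -> R) :
  (0 < a)%N ->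
  \sum_(s < a * b | (a %| s)%N && P s) f s = \sum_(j < b | P (a * j)%N) f (a * j)%N.
Proof.
move=> a0.
have lt_mul (j : 'I_b) : (a * j < a * b)%N by rewrite ltn_pmul2l.
have lt_div (s : 'I_(a * b)) : (s %/ a < b)%N by rewrite ltn_divLR // [(b * a)%N]mulnC.
rewrite (reindex_onto (fun j => Ordinal (lt_mul j)) (fun s => Ordinal (lt_div s))).
  apply: eq_bigl => j /=; rewrite dvdn_mulr //=.
  by rewrite -val_eqE /= mulKn // eqxx andbT.
by move=> s /andP[dvd_s _]; apply: val_inj; rewrite /= mulnC divnK.
Qed.

(** * Roots of unity and Ramanujan sums *)

Section Expi.

Variable R : realType.

Lemma expi0 : expi 0 = 1 :> R[i].
Proof. by rewrite /expi cos0 sin0. Qed.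

Lemma expiD (x y : R) : expi (x + y) = expi x * expi y.
Proof.
apply/eqP; rewrite eq_complex /= cosD sinD eqxx /=.
by rewrite addrC eqxx.
Qed.

Lemma expiX (x : R) n : expi x ^+ n = expi (x * n%:R).
Proof.
elim: n => [|n IHn]; first by rewrite mulr0 expi0 expr0.
by rewrite exprSr IHn -expiD -[in RHS]natr1 mulrDr mulr1.
Qed.

Lemma expi_2pi_nat n : expi (2 * pi * n%:R : R) = 1.
Proof.
rewrite -expiX mulr_natl /expi cos2pi sin2pi.
exact: expr1n.
Qed.

Lemma expi_2pi_modn (q n k : nat) : (0 < k)%N ->
  expi (2 * pi * q%:R * (n %% k)%N%:R / k%:R : R) =
  expi (2 * pi * q%:R * n%:R / k%:R).
Proof.
move=> k0; have k0' : k%:R != 0 :> R by rewrite pnatr_eq0 -lt0n.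
set c := 2 * pi * q%:R; rewrite [in RHS](divn_eq n k) natrD natrM.
rewrite (mulrDr c) (mulrDl (c * _)) expiD [in RHS]mulrA mulfK //.
rewrite /c -[in RHS]mulrA -natrM.
by rewrite expi_2pi_nat mul1r.
Qed.

Lemma expi_2pi_scale (q d i k : nat) : (0 < d)%N ->
  expi (2 * pi * q%:R * (d * i)%N%:R / (d * k)%N%:R : R) =
  expi (2 * pi * q%:R * i%:R / k%:R).
Proof.
move=> d0; have d0' : d%:R != 0 :> R by rewrite pnatr_eq0 -lt0n.
by rewrite !natrM mulrCA -mulf_div divff // mul1r.
Qed.

(** Sort the indices by [d = gcdn j k]: then [j = d * i] with [i] coprime to [k %/ d], and [j / k]
    reduces to [i / (k %/ d)]. The index 0 falls under [d = k] and yields the sum of modulus 1. *)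
Lemma sum_expi_ramanujan (q k : nat) : (0 < k)%N ->
  \sum_(j < k) expi (2 * pi * q%:R * j%:R / k%:R) =
  \sum_(d <- divisors k) ramanujan R (k %/ d) q.
Proof.
move=> k0; pose e (j : nat) := expi (2 * pi * q%:R * j%:R / k%:R : R).
transitivity (\sum_(d <- divisors k) \sum_(j < k | gcdn j k == d) e j).
  rewrite (exchange_big_dep predT) //=; apply: eq_bigr => j _.
  rewrite big_mkcond (bigD1_seq (gcdn j k)) ?divisors_uniq //=; last first.
    by rewrite -dvdn_divisors // dvdn_gcdr.
  by rewrite eqxx big1 ?addr0 // => d; rewrite eq_sym => /negbTE->.
apply: eq_big_seq => d; rewrite -dvdn_divisors // => dk.
have d0 : (0 < d)%N := dvdn_gt0 k0 dk.
rewrite /ramanujan /e -(divnK dk) mulnK // mulnC; set c := (k %/ d)%N.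
have gcd_eq (j : nat) :
    (gcdn j (d * c) == d) = (d %| j)%N && coprime (j %/ d) c.
  case: (boolP (d %| j)%N) => [/dvdnP[i ->]|ndj] /=.
    by rewrite [(i * d)%N]mulnC -muln_gcdr mulKn // -{2}(muln1 d) eqn_pmul2l.
  by apply: contraNF ndj => /eqP <-; exact: dvdn_gcdl.
under [LHS]eq_bigl do rewrite gcd_eq.
rewrite (sum_dvdn _ (fun j => coprime (j %/ d) c)
  (fun j => expi (2 * pi * q%:R * j%:R / (d * c)%N%:R))) //.
by apply: eq_big => i; rewrite ?mulKn // => _; exact: expi_2pi_scale.
Qed.

End Expi.

(** * The dimension formula *)

Section ProductOfCycles.

Variables (R : realType) (V : vectType R[i]) (m p : nat) (sigma : 'I_p -> 'S_m).
Hypothesis cycle_sigma : forall i, is_cycle (sigma i).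
Hypothesis disj_sigma : forall i j, i != j -> perm_disjoint (sigma i) (sigma j).
Hypothesis sum_order : m = (\sum_(i < p) #[sigma i]%g)%N.

Let g : 'S_m := (\prod_(i < p) sigma i)%g.

Lemma dim_symmetry_class_prod_cycles (q : nat) (lambda : 'S_m -> R[i]) :
    (forall s, (s < #[g]%g)%N ->
       lambda (g ^+ s)%g = expi (2 * pi * q%:R * s%:R / #[g]%g%:R)) ->
  (\dim (symmetry_class V <[g]>%G lambda))%:R =
    (\dim {:V})%:R *
    \sum_(i < p) ((#[g]%g %/ #[sigma i]%g)%N%:R^-1 *
      \sum_(d <- divisors (#[g]%g %/ #[sigma i]%g))
        ramanujan R (#[g]%g %/ #[sigma i]%g %/ d) q).
Proof.
move=> lambda_g; pose e s := expi (2 * pi * q%:R * s%:R / #[g]%g%:R : R).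
(* Periodicity extends the formula to all exponents, which makes [lambda] multiplicative without
   reducing [s + t] modulo the order. *)
have lambdaE s : lambda (g ^+ s)%g = e s.
  by rewrite -expg_mod_order lambda_g ?ltn_pmod // /e expi_2pi_modn.
have lambda1 : lambda 1%g = 1.
  by rewrite -(expg0 g) lambdaE /e mulr0 mul0r expi0.
rewrite dim_symmetry_class //=; first last.
- by rewrite pnatr_eq0 -lt0n cardG_gt0.
- move=> _ _ /cycleP[s ->] /cycleP[t ->].
  by rewrite -expgD !lambdaE /e natrD (mulrDr (_ * q%:R)) (mulrDl (_ * s%:R)) expiD.
congr (_ * _); rewrite big_cycle /= -[#|_|]/(#[g]%g).
have sum_ord : #|'I_m| = (\sum_(i < p) #[sigma i]%g)%N by rewrite card_ord.
under eq_bigr => s _.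
  rewrite lambdaE (card_fix_expg_prod cycle_sigma disj_sigma _ sum_ord).
  rewrite natr_sum mulr_sumr.
  over.
(* Summing over cycles first leaves, for each [i], only the exponents divisible by [#[sigma i]]. *)
rewrite (exchange_big_dep predT) //= mulr_sumr; apply: eq_bigr => i _.
have dvd_i : (#[sigma i]%g %| #[g]%g)%N.
  by rewrite (order_prod_disjoint_cycles cycle_sigma disj_sigma) (biglcmn_sup i).
set c := (#[g]%g %/ #[sigma i]%g)%N.
have def_g : #[g]%g = (#[sigma i]%g * c)%N by rewrite mulnC divnK.
have c0 : (0 < c)%N by have := order_gt0 g; rewrite def_g muln_gt0 => /andP[].
rewrite -mulr_suml -sum_expi_ramanujan // mulrCA mulrC.
rewrite /e def_g; under eq_bigl do rewrite -[(_ %| _)%N]andbT.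
rewrite (sum_dvdn _ predT (fun s => expi (2 * pi * q%:R * s%:R / _))) //.
congr (_ * _); last first.
  by apply: eq_bigr => j _; exact: expi_2pi_scale.
(* The [#[sigma i]] fixed points over the group order [#[sigma i] * c] give the factor [c^-1]. *)
by rewrite natrM invfM mulrAC mulVf ?mul1r // pnatr_eq0 -lt0n.
Qed.

End ProductOfCycles.

Theorem theorem3p2 (R : realType) (V : vectType R[i])
    (inner : {dot V for (@Num.conj R[i])}) (dimV : (2 <= \dim {:V})%N)
    (m : nat) :
  (forall (p : nat) (sigma : 'I_p -> 'S_m) (m_ : 'I_p -> nat),
     (0 < p)%N ->
     (forall i : 'I_p, is_cycle (sigma i)) ->
     (forall i j : 'I_p, i != j -> perm_disjoint (sigma i) (sigma j)) ->
     (forall i : 'I_p, #[sigma i]%g = m_ i) ->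
     m = (\sum_(i < p) m_ i)%N ->
     let g : 'S_m := (\prod_(i < p) sigma i)%g in
     let M : nat := \big[lcmn/1%N]_(i < p) m_ i in
     forall (q : nat) (lambda : 'S_m -> R[i]),
       (q < M)%N ->
       irreducible_character <[g]>%G lambda ->
       (forall s : nat, (s < M)%N ->
          lambda (g ^+ s)%g = expi (2 * pi * q%:R * s%:R / M%:R)) ->
       (\dim (symmetry_class V <[g]>%G lambda))%:R =
         (\dim {:V})%:R *
         \sum_(i < p)
            let m' := (M %/ m_ i)%N in
            (m'%:R)^-1 * \sum_(d <- divisors m') ramanujan R (m' %/ d) q)
  /\
  (forall sigma : 'S_m,
     is_cycle sigma ->
     #[sigma]%g = m ->
     forall (q : nat) (lambda : 'S_m -> R[i]),
       (q < m)%N ->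
       irreducible_character <[sigma]>%G lambda ->
       (forall s : nat, (s < m)%N ->
          lambda (sigma ^+ s)%g = expi (2 * pi * q%:R * s%:R / m%:R)) ->
       \dim (symmetry_class V <[sigma]>%G lambda) = \dim {:V}).

Proof.
split=> [p sigma m_ _ cycle_sigma disj_sigma order_sigma sum_m g M q lambda _ _|].
  have def_M : M = #[g]%g.
    rewrite (order_prod_disjoint_cycles cycle_sigma disj_sigma).
    by apply: eq_bigr => i _; rewrite order_sigma.
  have sum_order : m = (\sum_(i < p) #[sigma i]%g)%N.
    by apply: etrans sum_m _; apply: eq_bigr => i _; rewrite order_sigma.
  rewrite def_M => lambda_g.
  rewrite (dim_symmetry_class_prod_cycles V cycle_sigma disj_sigma sum_order lambda_g).
  by congr (_ * _); apply: eq_bigr => i _; rewrite /= order_sigma.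
move=> sigma cycle_sigma order_sigma q lambda _ _.
(* A single cycle is a family indexed by ['I_1], with vacuous disjointness. The quotient of orders
   is 1, so the sum collapses to the Ramanujan sum of modulus 1, which equals 1. *)
have prod_sigma : (\prod_(i < 1) sigma)%g = sigma by rewrite big_ord1.
have disj_sigma (i j : 'I_1) : i != j -> perm_disjoint sigma sigma.
  by rewrite !ord1.
have sum_order : m = (\sum_(i < 1) #[sigma]%g)%N by rewrite big_ord1.
have := dim_symmetry_class_prod_cycles V (fun=> cycle_sigma) disj_sigma sum_order
  (q := q) (lambda := lambda).
rewrite prod_sigma big_ord1 divnn order_gt0 /= order_sigma => dimE lambda_sigma.
(* The equality of naturals is read off in [R[i]], of characteristic 0. *)
apply/eqP; rewrite -(eqr_nat R[i]) dimE //.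
by rewrite big_seq1 /ramanujan divn1 big_ord1_cond /= mulr0 mul0r expi0 invr1 !mulr1.
Qed.
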